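(* Let $m,n\ge2$ be integers with $m$ even, let $\mathcal{A}\in T_{m,n}$, and suppose that the auxiliary matrix $\bar A$ of $\mathcal{A}$ is of the form $\bar A=\begin{pmatrix}M(\mathcal{A})&O\\O&O\end{pmatrix}$, where $M(\mathcal{A})$ is the majorization matrix of $\mathcal{A}$ and the $O$'s are zero blocks. Then the following are equivalent: (a) $M(\mathcal{A})$ is a column adequate matrix. (b) $\bar A$ is a column adequate matrix. (c) $\mathcal{A}$ is a column adequate tensor. (d) $LCP(\bar q,\bar A)$ has a $w$-unique solution for all $q\in\mathbb{R}^n$, where $\bar q=\begin{pmatrix}q\\0\end{pmatrix}\in\mathbb{R}^N$; i.e. for each $q$ all solutions $y$ of $LCP(\bar q,\bar A)$ give the same vector $w=\bar Ay+\bar q$. (e) $TCP(q,\mathcal{A})$ has an $\omega$-unique solution for all $q\in\mathbb{R}^n$; i.e. for each $q$ all solutions $x$ of $TCP(q,\mathcal{A})$ give the same vector $\omega=\mathcal{A}x^{m-1}+q$.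
   Context: $[n]=\{1,\dots,n\}$. $T_{m,n}$ denotes the set of real tensors $\mathcal{A}=(a_{i_1 i_2\cdots i_m})$ of order $m$ and dimension $n$. For $x\in\mathbb{R}^n$, $\mathcal{A}x^{m-1}\in\mathbb{R}^n$ is the vector with components $(\mathcal{A}x^{m-1})_i=\sum_{i_2,\dots,i_m=1}^n a_{i i_2\cdots i_m}x_{i_2}\cdots x_{i_m}$. Vector inequalities are componentwise. $TCP(q,\mathcal{A})$, for $q\in\mathbb{R}^n$: find $x\in\mathbb{R}^n$ with $x\ge0$, $\omega=\mathcal{A}x^{m-1}+q\ge0$, $x^T\omega=0$. $LCP(p,M)$, for $M\in\mathbb{R}^{k\times k}$, $p\in\mathbb{R}^k$: find $z\in\mathbb{R}^k$ with $z\ge0$, $w=Mz+p\ge0$, $z^Tw=0$. $w$-uniqueness and $\omega$-uniqueness mean that all solutions share the same $w$ (resp. $\omega$); existence of a solution is not asserted. Column adequate tensor: for every $x\in\mathbb{R}^n$, $x_i(\mathcal{A}x^{m-1})_i\le 0$ for all $i\in[n]$ implies $\mathcal{A}x^{m-1}=0$. Column adequate matrix $M\in\mathbb{R}^{k\times k}$: for every $z\in\mathbb{R}^k$, $z_i(Mz)_i\le0$ for all $i\in[k]$ implies $Mz=0$. Majorization matrix: $M(\mathcal{A})\in\mathbb{R}^{n\times n}$ with $M(\mathcal{A})_{ij}=a_{ijj\cdots j}$. Auxiliary matrix: let $N=\binom{m+n-2}{n-1}$ be the number of monomials of degree $m-1$ in $x_1,\dots,x_n$. List these monomials in modified graded lexicographic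 order: first the pure powers $x_1^{m-1},\dots,x_n^{m-1}$, then the monomials involving at least two distinct variables in decreasing lexicographic order (with $x_1>\cdots>x_n$). Let $A\in\mathbb{R}^{n\times N}$ be the matrix whose $(i,j)$ entry is the coefficient of the $j$-th monomial in $(\mathcal{A}x^{m-1})_i$. The auxiliary matrix is $\bar A=\begin{pmatrix}A\\O\end{pmatrix}\in\mathbb{R}^{N\times N}$ with $O$ the $(N-n)\times N$ zero matrix. (The first $n$ columns of $A$ form $M(\mathcal{A})$.) *)

(* Defs.v *)
From HB Require Import structures.
From mathcomp Require Import all_boot all_order all_algebra.
From mathcomp Require Import reals.
From mathcomp Require Import mpoly.

Set Implicit Arguments.
Unset Strict Implicit.
Unset Printing Implicit Defensive.

Import Order.TTheory GRing.Theory Num.Theory.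

Local Open Scope ring_scope.

Section Complementarity.
Variables (R : realType) (k : nat).

Definition nonneg (v : 'cV[R]_k) : Prop := forall i, 0 <= v i 0.

Definition lcp_solution (p : 'cV[R]_k) (M : 'M[R]_k) (z : 'cV[R]_k) : Prop :=
  [/\ nonneg z, nonneg (M *m z + p) & z^T *m (M *m z + p) = 0].

Definition lcp_w_unique (p : 'cV[R]_k) (M : 'M[R]_k) : Prop :=
  forall y z : 'cV[R]_k, lcp_solution p M y -> lcp_solution p M z ->
    M *m y + p = M *m z + p.

Definition column_adequate_mx (M : 'M[R]_k) : Prop :=
  forall z : 'cV[R]_k,
    (forall i, z i 0 * (M *m z) i 0 <= 0) -> M *m z = 0.

End Complementarity.

(* The entry a_(i_1 ... i_m) is A [tuple i_1; ...; i_m]. *)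
Definition tensor (R : Type) (m n : nat) := {ffun m.-tuple 'I_n -> R}.

Section Tensor.
Variables (R : realType) (m n : nat).
Implicit Types (A : tensor R m n) (x q : 'cV[R]_n).

(* (A x^(m-1))_i sums over the index tuples t = (i, i_2, ..., i_m), i.e. those
   with head i; behead t is (i_2, ..., i_m). *)
Definition tensor_app A x : 'cV[R]_n :=
  \col_i \sum_(t : m.-tuple 'I_n | ohead t == Some i)
           A t * \prod_(j <- behead t) x j 0.

Definition tcp_solution q A x : Prop :=
  [/\ nonneg x, nonneg (tensor_app A x + q) & x^T *m (tensor_app A x + q) = 0].

Definition tcp_omega_unique q A : Prop :=
  forall x y, tcp_solution q A x -> tcp_solution q A y ->
    tensor_app A x + q = tensor_app A y + q.

Definition column_adequate_tensor A : Prop :=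
  forall x, (forall i, x i 0 * (tensor_app A x) i 0 <= 0) -> tensor_app A x = 0.

Definition majorization_mx A : 'M[R]_n :=
  \matrix_(i, j) A [tuple if k == 0 :> nat then i else j | k < m].

Definition tensor_poly A (i : 'I_n) : {mpoly R[n]} :=
  \sum_(t : m.-tuple 'I_n | ohead t == Some i)
    A t *: \prod_(j <- behead t) 'X_j.

Lemma meval_tensor_poly A (x : 'cV[R]_n) i :
  (tensor_poly A i).@[fun j => x j 0] = tensor_app A x i 0.
Proof.
rewrite mxE raddf_sum /=; apply: eq_bigr => t _.
by rewrite mevalZ rmorph_prod /=; congr (_ * _); apply: eq_bigr => j _; rewrite mevalXU.
Qed.

End Tensor.

Section Monomials.
Variables m n : nat.

Definition pure_powers : seq 'X_{1..n} :=
  [seq (U_(i) *+ m.-1)%MM | i <- enum 'I_n].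

(* Decreasing lexicographic order on exponent vectors, hence x_1 > ... > x_n. *)
Definition lex_ge (u v : 'X_{1..n}) : bool :=
  ((v : seqlexi nat) <= (u : seqlexi nat))%O.

Definition is_mixed (u : 'X_{1..n}) : bool :=
  (mdeg u == m.-1) && (1 < #|[set i | (0 < u i)%N]|)%N.

Definition mixed_monomials : seq 'X_{1..n} :=
  sort lex_ge [seq u <- [seq bmnm b | b : 'X_{1..n < m}] | is_mixed u].

Definition monomials : seq 'X_{1..n} := pure_powers ++ mixed_monomials.

Definition nmonomials : nat := 'C(m + n - 2, n - 1).

Lemma mem_mixed u : (1 < m)%N -> (u \in mixed_monomials) = is_mixed u.
Proof.
move=> m1; rewrite mem_sort mem_filter andbC; case: (boolP (is_mixed u)) => [|_].
  case/andP=> /eqP du _; rewrite andbT.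
  have lt_u : (mdeg u < m)%N by rewrite du prednK // ltnW.
  by apply/mapP; exists (BMultinom lt_u); rewrite ?mem_enum.
by rewrite andbF.
Qed.

Lemma uniq_mixed : uniq mixed_monomials.
Proof. by rewrite sort_uniq filter_uniq // map_inj_uniq ?enum_uniq //; exact: val_inj. Qed.

Lemma mem_pure u : (1 < m)%N ->
  (u \in pure_powers) = (mdeg u == m.-1) && (#|[set i | (0 < u i)%N]| == 1)%N.
Proof.
move=> m1; have m0 : (0 < m.-1)%N by case: m m1 => [|[]].
apply/mapP/andP => [[i _ ->]|[/eqP du /cards1P[i E]]].
  split; first by rewrite mdegMn mdeg1 mul1n.
  apply/cards1P; exists i; apply/setP=> j; rewrite !inE mulmnE mnm1E eq_sym.
  by case: eqP => _; rewrite ?mul1n ?mul0n.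
exists i; first by rewrite mem_enum.
have z j : j != i -> u j = 0%N.
  move=> ji; have /setP/(_ j) := E; rewrite !inE (negbTE ji).
  by case: (u j).
apply/mnmP=> j; rewrite mulmnE mnm1E eq_sym -du.
case: (eqVneq j i) => [->|/z ->]; last by rewrite mul0n.
by rewrite mul1n mdegE (bigD1 i) //= big1 ?addn0 // => k /z.
Qed.

Lemma mem_monomials u : (1 < m)%N -> (u \in monomials) = (mdeg u == m.-1).
Proof.
move=> m1; rewrite mem_cat mem_pure // mem_mixed // /is_mixed -andb_orr.
case: eqP => //= du; rewrite eq_sym -leq_eqVlt card_gt0.
apply/set0Pn; have : (0 < mdeg u)%N by rewrite du; case: m m1 => [|[]].
rewrite mdegE lt0n sum_nat_eq0 negb_forall => /existsP[i]; rewrite implyTb => ui.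
by exists i; rewrite inE lt0n.
Qed.

Lemma uniq_monomials : (1 < m)%N -> uniq monomials.
Proof.
move=> m1; have m0 : (0 < m.-1)%N by case: m m1 => [|[]].
rewrite cat_uniq uniq_mixed andbT map_inj_in_uniq ?enum_uniq /=; last first.
  move=> i j _ _ /mnmP/(_ i); rewrite !mulmnE !mnm1E eqxx mul1n.
  by case: eqP => // _; rewrite mul0n => e; rewrite e in m0.
apply/hasPn=> u; rewrite mem_mixed // => /andP[_ c]; rewrite mem_pure //.
by rewrite (gtn_eqF c) andbF.
Qed.

Lemma size_monomials : (1 < m)%N -> (0 < n)%N -> size monomials = nmonomials.
Proof.
move=> m1 n0.
pose s := [seq s2m t | t : m.-1.-tuple 'I_n <- enum (basis n m.-1)].
have : perm_eq monomials s.
  apply: uniq_perm; rewrite ?uniq_monomials ?uniq_basis // => u.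
  by rewrite mem_monomials // basis_cover.
move/perm_size ->; rewrite /s /nmonomials; case: {s} n n0 => // k _.
rewrite size_basis -bin_sub ?leq_addr // addKn.
by congr 'C(_, _); case: m m1 => [|[|p]] // _ /=; rewrite ?subn1 // !addSn !addnS !subSS subn0.
Qed.

Lemma leq_nmonomials : (1 < m)%N -> (0 < n)%N -> (n <= nmonomials)%N.
Proof.
move=> m1 n0; rewrite -size_monomials // size_cat size_map size_enum_ord.
exact: leq_addr.
Qed.

End Monomials.

Section Auxiliary.
Variables (R : realType) (m n : nat).

(* nmonomials m n is written n + (nmonomials m n - n), which is licit by
   leq_nmonomials, so that the blocks of size n are visible in the types. *)
Definition aux_dim : nat := (n + (nmonomials m n - n))%N.

Lemma aux_dimE : (1 < m)%N -> (0 < n)%N -> aux_dim = nmonomials m n.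
Proof. by move=> m1 n0; rewrite /aux_dim subnKC // leq_nmonomials. Qed.

Definition coeff_mx (A : tensor R m n) : 'M[R]_(n, aux_dim) :=
  \matrix_(i, j) (tensor_poly A i)@_(nth 0%MM (monomials m n) j).

Lemma lsubmx_coeff_mx A : (1 < m)%N -> lsubmx (coeff_mx A) = majorization_mx A.
Proof.
move=> m1; apply/matrixP=> i j; rewrite !mxE /= nth_cat size_map size_enum_ord ltn_ord.
rewrite (nth_map j) ?size_enum_ord // nth_ord_enum.
set u := (_ *+ _)%MM.
have eE (s : seq 'I_n) : \prod_(k <- s) ('X_k : {mpoly R[n]}) = 'X_[\big[mnm_add/0%MM]_(k <- s) U_(k)%MM].
  by elim: s => [|k s IH]; rewrite ?big_nil ?mpolyX0 // !big_cons mpolyXD IH.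
rewrite linear_sum /=.
set t0 := [tuple _ | k < m].
have t0h : t0 = i :: nseq m.-1 j :> seq 'I_n.
  apply: (@eq_from_nth _ i) => [|k]; rewrite size_tuple /= ?size_nseq ?prednK // ?(ltnW m1) // => km.
  rewrite -(tnth_nth i t0 (Ordinal km)) tnth_mktuple /=.
  by case: k km => //= k km; rewrite nth_nseq -ltnS prednK ?km // ltnW.
rewrite (bigD1 t0) ?t0h /= ?eqxx // [X in _ + X]big1 ?addr0.
  rewrite mcoeffZ eE mcoeffX big_nseq; have -> : iter m.-1 (mnm_add U_(j)) 0%MM = u.
    by elim: (m.-1) @u => [|k /= ->]; rewrite ?mulm0n ?mulmS.
  by rewrite eqxx mulr1.
move=> t /andP[ti tn]; rewrite mcoeffZ eE mcoeffX.
case: eqP => [e|]; last by rewrite mulr0.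
case/eqP: tn; apply: val_inj; rewrite /= t0h.
have sz := size_tuple t.
case: (tval t) ti sz e => //= a s /eqP[->] sz e; congr (_ :: _); rewrite -sz /=.
apply/all_pred1P/allP=> k ks /=; apply/eqP; apply: contraTeq isT => kj.
have /mnmP/(_ k) := e; rewrite (big_rem k) //= mnmDE mulmnE !mnm1E eqxx.
by rewrite eq_sym (negbTE kj) mul0n.
Qed.
Definition auxiliary_mx (A : tensor R m n) : 'M[R]_aux_dim :=
  col_mx (coeff_mx A) (0 : 'M[R]_(nmonomials m n - n, aux_dim)).

Definition pad_vec (q : 'cV[R]_n) : 'cV[R]_aux_dim :=
  col_mx q (0 : 'cV[R]_(nmonomials m n - n)).

End Auxiliary.

(* Main.v *)
(* The block form of the auxiliary matrix says exactly that
   A x^(m-1) = M(A) x^[m-1], where x^[m-1] is the entrywise power. Since m - 1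
   is odd, x |-> x^[m-1] is a sign-preserving bijection of R^n, so everything
   reduces to Ingleton's theorem for the matrix M(A): column adequacy is
   w-uniqueness of LCP(q, M(A)) for every q. *)
Require Import Defs.
From HB Require Import structures.
From mathcomp Require Import all_boot all_order all_algebra.
From mathcomp Require Import reals.
From mathcomp Require Import mpoly.
From mathcomp Require Import lra.

Set Implicit Arguments.
Unset Strict Implicit.
Unset Printing Implicit Defensive.

Import Order.TTheory GRing.Theory Num.Theory.

Local Open Scope ring_scope.

(** * Odd powers: roots and signs *)

Lemma odd_root (R : rcfType) (k : nat) (y : R) : odd k -> exists x, x ^+ k = y.
Proof.
move=> ok; have k0 : (0 < k)%N by case: k ok.
(* As [b] is at least 1, |y| <= b <= b^k. With [k] odd, X^k - y is then nonpositive at -b and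
   nonnegative at b, and a root lies between. *)
pose b := 1 + `|y|; have b1 : 1 <= b by rewrite lerDl.
have b0 : 0 <= b by apply: le_trans b1.
have yb : `|y| <= b ^+ k by apply: le_trans (ler_eXnr k0 b1); rewrite lerDr.
have [||x _] := @poly_ivt R ('X^k - y%:P) (- b) b.
- by rewrite (le_trans _ b0) // oppr_le0.
- move: yb; rewrite !hornerE exprNn -signr_odd ok expr1 mulN1r ler_norml => /andP[h1 h2].
  by rewrite subr_le0 subr_ge0 h1 h2.
by rewrite rootE !hornerE subr_eq0 => /eqP <-; exists x.
Qed.

(** The power is [x] times an even power of [x], which is positive unless x = 0. *)
Lemma mulr_exp_odd_le0 (R : realDomainType) (k : nat) (x y : R) :
  odd k -> (x ^+ k * y <= 0) = (x * y <= 0).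
Proof.
case: k => // k /= ek; have [->|x0] := eqVneq x 0; first by rewrite expr0n !mul0r.
by rewrite exprSr -mulrA pmulr_rle0 // exprn_even_gt0 // x0 orbT.
Qed.

(** * Column adequacy and w-uniqueness for matrices *)

Section Complementarity.
Variables (R : realType) (k : nat).
Implicit Types (p z : 'cV[R]_k) (M : 'M[R]_k).

Lemma complementary_mxP (z w : 'cV[R]_k) : nonneg z -> nonneg w ->
  (z^T *m w = 0) <-> (forall i, z i 0 * w i 0 = 0).
Proof.
move=> z0 w0; split=> [/matrixP/(_ 0 0)|h]; last first.
  by apply/matrixP=> a b; rewrite !ord1 !mxE big1 // => i _; rewrite mxE h.
rewrite !mxE; under eq_bigr do rewrite mxE; move=> s0 i.
by apply: (psumr_eq0P _ s0) => // j _; rewrite mulr_ge0.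
Qed.

Lemma lcp_w_unique_adequate M :
  (forall q, lcp_w_unique q M) <-> column_adequate_mx M.
Proof.
split=> [uM z zM | aM q y z [y0 v0 yv] [z0 w0 zw]]; last first.
  have {}yv := (complementary_mxP y0 v0).1 yv.
  have {}zw := (complementary_mxP z0 w0).1 zw.
  congr (_ + _); apply/eqP; rewrite -subr_eq0 -mulmxBr; apply/eqP/aM => i.
  have -> : (M *m (y - z)) i 0 = (M *m y + q) i 0 - (M *m z + q) i 0.
    by rewrite mulmxBr !mxE opprD addrACA subrr addr0.
  (* Complementarity kills the diagonal products; what remains is minus the sum of the two cross
     products, each nonnegative. *)
  rewrite [(y - z) i 0]mxE [(- z) i 0]mxE mulrBl !mulrBr yv zw sub0r subr0.
  by rewrite -opprD oppr_le0 addr_ge0 ?mulr_ge0.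
(* The positive and negative parts of z solve the same problem, with the
   positive and negative parts of M z as the respective w. *)
pose pos (v : 'cV[R]_k) : 'cV[R]_k := \col_i Num.max (v i 0) 0.
have pos0 v : nonneg (pos v) by move=> i; rewrite mxE le_max lexx orbT.
have posB v : pos v - pos (- v) = v.
  apply/matrixP=> i j; rewrite !mxE {j}ord1.
  by case: (leP (v i 0) 0) => h; case: leP => h'; lra.
have posM (u v : 'cV[R]_k) : (forall i, u i 0 * v i 0 <= 0) ->
    (pos u)^T *m pos v = 0.
  move=> uv; apply/complementary_mxP => // i; rewrite !mxE.
  case: leP => u0; rewrite ?mul0r //; case: leP => v0; rewrite ?mulr0 //.
  by have := uv i; rewrite leNgt mulr_gt0.
(* Chosen so that pos z has pos (M z) as its w. The same [q] serves pos (- z), since z and M z are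
   each the difference of their two parts. *)
pose q := pos (M *m z) - M *m pos z.
have qE : q = pos (- (M *m z)) - M *m pos (- z).
  have posD v : pos v = v + pos (- v) by rewrite -{2}(posB v) subrK.
  by rewrite /q (posD z) (posD (M *m z)) mulmxDr opprD addrACA subrr add0r.
have [sP sN] : lcp_solution q M (pos z) /\ lcp_solution q M (pos (- z)).
  split; [rewrite /q | rewrite qE]; split; rewrite // addrC subrK //; apply: posM => // i.
  by rewrite !mxE mulrNN; have := zM i; rewrite mxE.
(* Uniqueness equates the positive and negative parts of M z, whose difference is M z. *)
have := uM q _ _ sP sN; rewrite {1}/q qE ![_ *m _ + _]addrC !subrK => e.
by rewrite -(posB (M *m z)) e subrr.
Qed.
End Complementarity.

(** * The tensor map through its coefficient matrix *)

Section Tensor.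
Variables (R : realType) (m n : nat).
Implicit Types (A : tensor R m n) (x : 'cV[R]_n).

(** Every summand is a scaled product of m - 1 variables. Hence [monomials], which lists exactly the
    exponents of degree m - 1, captures the whole polynomial. *)
Lemma mcoeff_tensor_poly_deg A i u : mdeg u != m.-1 -> (tensor_poly A i)@_u = 0.
Proof.
move=> du; rewrite linear_sum big1 //= => t _; rewrite mcoeffZ.
have -> (s : seq 'I_n) : \prod_(k <- s) ('X_k : {mpoly R[n]})
    = 'X_[\big[mnm_add/0%MM]_(k <- s) U_(k)%MM].
  by elim: s => [|k s IH]; rewrite ?big_nil ?mpolyX0 // !big_cons mpolyXD IH.
rewrite mcoeffX; case: eqP => [e|]; last by rewrite mulr0.
case/eqP: du; rewrite -e mdeg_sum.
have <- : size (behead t) = m.-1 by rewrite size_behead size_tuple.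
by under eq_bigr do rewrite mdeg1; rewrite sum1_size.
Qed.

Lemma tensor_app_coeff_mx A x i : (1 < m)%N -> (0 < n)%N ->
  tensor_app A x i 0 = \sum_j coeff_mx A i j *
    'X_[nth 0%MM (monomials m n) j].@[fun k => x k 0].
Proof.
move=> m1 n0; rewrite -meval_tensor_poly.
have -> : tensor_poly A i =
    \sum_(u <- monomials m n) (tensor_poly A i)@_u *: 'X_[u].
  have := @mcoeff_tensor_poly_deg A i; move: (tensor_poly A i) => p p0.
  apply/mpolyP=> u; rewrite linear_sum /=.
  under eq_bigr do rewrite mcoeffZ mcoeffX.
  have [um|] := boolP (u \in monomials m n).
    rewrite (bigD1_seq u) ?uniq_monomials //= eqxx mulr1 big1 ?addr0 // => v.
    by move=> /negbTE->; rewrite mulr0.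
  move=> um; rewrite big_seq big1 => [|v vm].
    by rewrite p0 // -mem_monomials.
  by case: eqP => [e|]; rewrite ?mulr0 // -e vm in um *.
rewrite linear_sum /= (big_nth 0%MM) size_monomials // -aux_dimE // big_mkord.
by apply: eq_bigr => j _; rewrite mevalZ mxE.
Qed.

(** The columns of the mixed monomials vanish, and the first n entries of [monomials] are the pure
    powers. *)
Lemma tensor_app_pure A x : (1 < m)%N -> (0 < n)%N ->
    auxiliary_mx A = block_mx (majorization_mx A) 0 0 0 ->
  tensor_app A x = majorization_mx A *m map_mx (fun a => a ^+ m.-1) x.
Proof.
move=> m1 n0 hA; apply/matrixP=> i j; rewrite {j}ord1 tensor_app_coeff_mx //.
have -> : coeff_mx A = row_mx (majorization_mx A) 0.
  by move/(congr1 usubmx): hA; rewrite /auxiliary_mx block_mxEv !col_mxKu.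
rewrite big_split_ord /= [X in _ + X]big1 => [|j _]; last first.
  by rewrite row_mxEr mxE mul0r.
rewrite addr0 mxE; apply: eq_bigr => j _; rewrite row_mxEl mxE; congr (_ * _).
rewrite nth_cat size_map size_enum_ord ltn_ord (nth_map j) ?size_enum_ord //.
by rewrite nth_ord_enum -mpolyXn rmorphXn /= mevalXU mxE.
Qed.

End Tensor.

(** * Padding a matrix by zero blocks *)

Section BlockMatrix.
Variables (R : realType) (n k : nat) (M : 'M[R]_n).
Let B : 'M[R]_(n + k) := block_mx M 0 0 0.

Lemma mul_block_mx_col (x : 'cV[R]_n) (y : 'cV[R]_k) :
  B *m col_mx x y = col_mx (M *m x) 0.
Proof. by rewrite mul_block_col !mul0mx !addr0. Qed.

Lemma column_adequate_block_mx : column_adequate_mx B <-> column_adequate_mx M.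
Proof.
split=> ad z zM.
  have := ad (col_mx z 0); rewrite mul_block_mx_col => h.
  apply/matrixP=> i j; have /matrixP/(_ (lshift k i) j) : col_mx (M *m z) 0 = 0 :> 'cV_(n + k).
    apply: h => l; case: (split_ordP l) => l' ->.
      by rewrite !col_mxEu.
    by rewrite !col_mxEd mxE mul0r.
  by rewrite col_mxEu !mxE.
rewrite -[z]vsubmxK mul_block_mx_col ad ?col_mx0 // => i.
by have := zM (lshift k i); rewrite -{1 2}[z]vsubmxK mul_block_mx_col !col_mxEu.
Qed.

(** The padded rows of w are zero, so [y] meets complementarity for free and only its sign is
    constrained. *)
Lemma lcp_solution_block_mx (q x : 'cV[R]_n) (y : 'cV[R]_k) :
  lcp_solution (col_mx q 0) B (col_mx x y) <-> lcp_solution q M x /\ nonneg y.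
Proof.
rewrite /lcp_solution mul_block_mx_col add_col_mx addr0 tr_col_mx mul_row_col mulmx0 addr0.
split=> [[n1 n2 e]|[[n1 n2 e] n3]].
  split; first split => // i.
  - by have := n1 (lshift k i); rewrite col_mxEu.
  - by have := n2 (lshift k i); rewrite col_mxEu.
  by move=> i; have := n1 (rshift n i); rewrite col_mxEd.
by split=> // i; case: (split_ordP i) => j ->; rewrite ?col_mxEu ?col_mxEd // mxE.
Qed.

Lemma lcp_w_unique_block_mx (q : 'cV[R]_n) :
  lcp_w_unique (col_mx q 0) B <-> lcp_w_unique q M.
Proof.
split=> uq y z.
  move=> sy sz; have n0 : nonneg (0 : 'cV[R]_k) by move=> i; rewrite mxE.
  have := uq (col_mx y 0) (col_mx z 0).
  rewrite !lcp_solution_block_mx !mul_block_mx_col !add_col_mx => h.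
  by have /eq_col_mx[] := h (conj sy n0) (conj sz n0).
rewrite -[y]vsubmxK -[z]vsubmxK !lcp_solution_block_mx => -[sy _] [sz _].
by rewrite !mul_block_mx_col !add_col_mx (uq _ _ sy sz).
Qed.

End BlockMatrix.

(** * Transfer along the entrywise odd power *)

Section PureTensor.
Variables (R : realType) (m n : nat) (A : tensor R m n) (M : 'M[R]_n).
Hypothesis m_even : ~~ odd m.
Hypothesis m_gt1 : (1 < m)%N.
Let pw (x : 'cV[R]_n) := map_mx (fun a => a ^+ m.-1) x.
Hypothesis appE : forall x, tensor_app A x = M *m pw x.

Let odd_m1 : odd m.-1.
Proof. by case: m m_even m_gt1 => //= p; rewrite negbK. Qed.

Let pw_surj y : exists x, pw x = y.
Proof.
have r i := odd_root (y i 0) odd_m1.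
have [f fP] := fin_all_exists r.
by exists (\col_i f i); apply/matrixP=> i j; rewrite !mxE ord1.
Qed.

Lemma column_adequate_pure : column_adequate_tensor A <-> column_adequate_mx M.
Proof.
split=> ad x => [|h].
  have [{}x <-] := pw_surj x; rewrite -appE => h; apply: ad => i.
  by have := h i; rewrite mxE mulr_exp_odd_le0.
rewrite appE; apply: ad => i.
by rewrite [pw x i 0]mxE mulr_exp_odd_le0 // -appE.
Qed.

Lemma tcp_solution_pure q x : tcp_solution q A x <-> lcp_solution q M (pw x).
Proof.
have nnE : nonneg (pw x) <-> nonneg x.
  by split=> h i; have := h i; rewrite mxE exprn_odd_ge0.
rewrite /tcp_solution /lcp_solution appE; move: (M *m _ + q) => w.
(* For nonnegative vectors orthogonality is entrywise, so it depends only on which entries vanish,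
   and [pw] preserves those. *)
have wE : nonneg x -> nonneg w -> x^T *m w = 0 <-> (pw x)^T *m w = 0.
  move=> x0 w0; rewrite !complementary_mxP //; last exact/nnE.
  have xwE i : (pw x i 0 * w i 0 == 0) = (x i 0 * w i 0 == 0).
    by rewrite [pw x i 0]mxE !mulf_eq0 expf_eq0 odd_gt0.
  by split=> h i; apply/eqP; [rewrite xwE|rewrite -xwE]; apply/eqP.
by split=> -[x0 w0 xw]; split=> //; try (exact/nnE); apply/wE => //; exact/nnE.
Qed.

Lemma tcp_omega_unique_pure q : tcp_omega_unique q A <-> lcp_w_unique q M.
Proof.
split=> uq x y.
  (* By surjectivity every candidate for the LCP is the power of a candidate for the TCP, with the
     same w. *)
  have [{}x <-] := pw_surj x; have [{}y <-] := pw_surj y.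
  by rewrite -!tcp_solution_pure -!appE; apply: uq.
by rewrite !tcp_solution_pure !appE; apply: uq.
Qed.

End PureTensor.

Theorem theorem3p11 (R : realType) (m n : nat) (hm : (1 < m)%N) (hn : (1 < n)%N)
    (m_even : ~~ odd m) (A : tensor R m n)
    (hA : auxiliary_mx A = block_mx (majorization_mx A) 0 0 0) :
  [<-> (* a *) column_adequate_mx (majorization_mx A);
       (* b *) column_adequate_mx (auxiliary_mx A);
       (* c *) column_adequate_tensor A;
       (* d *) forall q : 'cV[R]_n, lcp_w_unique (pad_vec m q) (auxiliary_mx A);
       (* e *) forall q : 'cV[R]_n, tcp_omega_unique q A].
Proof.
have appE x := tensor_app_pure x hm (ltnW hn) hA.
have ab : column_adequate_mx (auxiliary_mx A) <-> column_adequate_mx (majorization_mx A).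
  by rewrite hA; exact: column_adequate_block_mx.
have ac := column_adequate_pure m_even hm appE.
have aq := lcp_w_unique_adequate (majorization_mx A).
have dq q : lcp_w_unique (pad_vec m q) (auxiliary_mx A) <->
    lcp_w_unique q (majorization_mx A).
  by rewrite hA; exact: lcp_w_unique_block_mx.
have eq q := tcp_omega_unique_pure m_even hm appE q.
(* The cycle a, b, c, d, e, a; adequacy turns into uniqueness from c to d and back from e to a. *)
tfae.
- by move/ab.
- by move/ab/ac.
- by move/ac/aq => h q; apply/dq.
- by move=> h q; apply/eq/dq.
- by move=> h; apply/aq => q; apply/eq.
Qed.
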